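(* Let $\mathbb E$ be a finitely complete category and $v:U\rightarrowtail T$ a monomorphism in $\mathbb E$. Suppose that $\mathbb E$ is pointed and that $v$ has a normalizer, given by $(u,R_v)$ with $u:U\rightarrowtail X$ normal to $R_v$ and $w:X\rightarrow T$ with $v=w\circ u$. Then the factorization $w$ is necessarily a monomorphism.
   Context: **Normal monomorphisms.** Let $\mathbb E$ be a finitely complete category. For an equivalence relation $(d_0,d_1):R\rightrightarrows X$, a monomorphism $u:U\rightarrowtail X$ is said to be *normal to* $R$ if: (i) $u^{-1}(R)=\nabla_U$, where $\nabla_U=U\times U$ is the indiscrete equivalence relation on $U$; (ii) the induced internal functor from $\nabla_U$ to $R$, given by $u$ and $\tilde u:U\times U\rightarrowtail R$ with $d_i\circ\tilde u=u\circ p_i$ ($i=0,1$), is a discrete fibration, i.e. these commutative squares are pullbacks. **Normalizers.** A monomorphism $v:U\rightarrowtail T$ *has a normalizer* when there is a pair $(u,R_v)$, where $u:U\rightarrowtail X$ is a monomorphism normal to the equivalence relation $R_v$ on $X$, together with a map $w:X\rightarrow T$ such that $v=w\circ u$, which is universal among such decompositions: for every equivalence relation $S$ on an object $X'$, every monomorphism $u':U\rightarrowtail X'$ normal to $S$ and every map $h:X'\rightarrow T$ with $v=h\circ u'$, there is a unique map $h':X'\rightarrow X$ such that $w\circ h'=h$, $h'\circ u'=u$ and $h'$ underlies a map of equivalence relations $S\rightarrow R_v$. ($w$ is not assumed to be a monomorphism in this definition.) *)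

(* Defs.v *)
(* Stdlib only. *)
From Stdlib Require Import List FinFun.

Set Implicit Arguments.
Unset Strict Implicit.
Unset Printing Implicit Defensive.

Record category := Category {
  obj :> Type;
  hom : obj -> obj -> Type;
  idm : forall A, hom A A;
  comp : forall A B C, hom B C -> hom A B -> hom A C;
  comp1m : forall A B (f : hom A B), comp (idm B) f = f;
  compm1 : forall A B (f : hom A B), comp f (idm A) = f;
  compA : forall A B C D (f : hom A B) (g : hom B C) (h : hom C D),
    comp h (comp g f) = comp (comp h g) f
}.

Arguments hom {c} A B.
Arguments idm {c} A.
Arguments comp {c A B C} g f.

Declare Scope cat_scope.
Delimit Scope cat_scope with cat.
Notation "g ∘ f" := (comp g f) (at level 40, left associativity) : cat_scope.
Open Scope cat_scope.

Record functor (J E : category) := Functor {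
  fobj :> J -> E;
  fmap : forall i j, hom i j -> hom (fobj i) (fobj j);
  fmap1 : forall i, fmap (idm i) = idm (fobj i);
  fmapM : forall i j k (g : hom j k) (f : hom i j),
    fmap (g ∘ f) = fmap g ∘ fmap f
}.

Definition is_cone (J E : category) (F : functor J E) (L : E)
    (p : forall j, hom L (F j)) : Prop :=
  forall i j (f : hom i j), fmap F f ∘ p i = p j.

Definition is_limit (J E : category) (F : functor J E) (L : E)
    (p : forall j, hom L (F j)) : Prop :=
  is_cone p /\
  forall (Z : E) (q : forall j, hom Z (F j)), is_cone q ->
    exists! h : hom Z L, forall j, p j ∘ h = q j.

Definition finite_category (J : category) : Prop :=
  Finite J /\ forall i j : J, Finite (hom i j).

Definition finitely_complete (E : category) : Prop :=
  forall (J : category) (F : functor J E), finite_category J ->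
    exists (L : E) (p : forall j, hom L (F j)), is_limit p.

Section Notions.

Variable E : category.

Definition is_terminal (Z : E) : Prop :=
  forall A : E, exists! f : hom A Z, True.

Definition is_initial (Z : E) : Prop :=
  forall A : E, exists! f : hom Z A, True.

Definition pointed : Prop := exists Z : E, is_initial Z /\ is_terminal Z.

Definition monic (A B : E) (m : hom A B) : Prop :=
  forall (Z : E) (a b : hom Z A), m ∘ a = m ∘ b -> a = b.

Definition is_product (A B P : E) (p0 : hom P A) (p1 : hom P B) : Prop :=
  forall (Z : E) (a : hom Z A) (b : hom Z B),
    exists! h : hom Z P, p0 ∘ h = a /\ p1 ∘ h = b.

(* The square
     P --q--> B
     |p       |g
     A --f--> C   *)
Definition is_pullback (A B C P : E) (f : hom A C) (g : hom B C)
    (p : hom P A) (q : hom P B) : Prop :=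
  f ∘ p = g ∘ q /\
  forall (Z : E) (a : hom Z A) (b : hom Z B), f ∘ a = g ∘ b ->
    exists! h : hom Z P, p ∘ h = a /\ q ∘ h = b.

(* A parallel pair d0, d1 : carrier ⇉ X. *)
Record graph (X : E) := Graph {
  carrier : E;
  d0 : hom carrier X;
  d1 : hom carrier X
}.

Definition jointly_monic (X : E) (R : graph X) : Prop :=
  forall (Z : E) (a b : hom Z (carrier R)),
    d0 R ∘ a = d0 R ∘ b -> d1 R ∘ a = d1 R ∘ b -> a = b.

Definition reflexive_graph (X : E) (R : graph X) : Prop :=
  exists s : hom X (carrier R), d0 R ∘ s = idm X /\ d1 R ∘ s = idm X.

Definition symmetric_graph (X : E) (R : graph X) : Prop :=
  exists t : hom (carrier R) (carrier R),
    d0 R ∘ t = d1 R /\ d1 R ∘ t = d0 R.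

(* In a finitely complete category the object R ×_X R of composable pairs
   exists and is unique up to isomorphism, so any one may be used. *)
Definition transitive_graph (X : E) (R : graph X) : Prop :=
  forall (P : E) (p q : hom P (carrier R)),
    is_pullback (d1 R) (d0 R) p q ->
    exists m : hom P (carrier R),
      d0 R ∘ m = d0 R ∘ p /\ d1 R ∘ m = d1 R ∘ q.

Definition equivalence_relation (X : E) (R : graph X) : Prop :=
  jointly_monic R /\ reflexive_graph R /\ symmetric_graph R /\
  transitive_graph R.

(* The pair (g, gt) is a morphism of graphs S -> R; between equivalence
   relations this is the same as an internal functor, and gt is determined
   by g. *)
Definition graph_map (Y X : E) (S : graph Y) (R : graph X)
    (g : hom Y X) (gt : hom (carrier S) (carrier R)) : Prop :=
  d0 R ∘ gt = g ∘ d0 S /\ d1 R ∘ gt = g ∘ d1 S.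

Definition discrete_fibration (Y X : E) (S : graph Y) (R : graph X)
    (g : hom Y X) (gt : hom (carrier S) (carrier R)) : Prop :=
  is_pullback (d0 R) g gt (d0 S) /\ is_pullback (d1 R) g gt (d1 S).

(* N is the indiscrete relation on U: its legs are the projections of a
   product U × U. *)
Definition is_indiscrete (U : E) (N : graph U) : Prop :=
  is_product (d0 N) (d1 N).

(* N = u^{-1}(R), that is, the square
     N ----gt----> R
     |             |
     |<d0,d1>      |<d0,d1>
     v             v
   U × U -u×u-> X × X
   is a pullback. *)
Definition is_inverse_image (U X : E) (u : hom U X) (R : graph X)
    (N : graph U) (gt : hom (carrier N) (carrier R)) : Prop :=
  exists (UU XX : E) (p0 p1 : hom UU U) (q0 q1 : hom XX X)
    (n : hom (carrier N) UU) (r : hom (carrier R) XX) (uu : hom UU XX),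
    is_product p0 p1 /\ is_product q0 q1 /\
    (p0 ∘ n = d0 N /\ p1 ∘ n = d1 N) /\
    (q0 ∘ r = d0 R /\ q1 ∘ r = d1 R) /\
    (q0 ∘ uu = u ∘ p0 /\ q1 ∘ uu = u ∘ p1) /\
    is_pullback r uu gt n.

(* N and ut are unique up to isomorphism. *)
Definition normal_to (U X : E) (u : hom U X) (R : graph X) : Prop :=
  exists (N : graph U) (ut : hom (carrier N) (carrier R)),
    is_indiscrete N /\
    is_inverse_image u ut /\
    graph_map u ut /\
    discrete_fibration u ut.

(* The data u : U -> X, R on X and w : X -> T form a normalizer of v. *)
Definition is_normalizer (U T : E) (v : hom U T) (X : E) (u : hom U X)
    (R : graph X) (w : hom X T) : Prop :=
  monic u /\ equivalence_relation R /\ normal_to u R /\ v = w ∘ u /\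
  forall (X' : E) (S : graph X') (u' : hom U X') (h : hom X' T),
    equivalence_relation S -> monic u' -> normal_to u' S -> v = h ∘ u' ->
    exists! h' : hom X' X,
      w ∘ h' = h /\ h' ∘ u' = u /\
      exists ht : hom (carrier S) (carrier R), graph_map h' ht.

End Notions.

Arguments pointed E : clear implicits.

(* Main.v *)
Require Import Defs.
From Stdlib Require Import List ssreflect.

(** The normalizer property is tested on the kernel pair of [w].  Let
    [pi0, pi1 : K -> X] be this kernel pair, so that [K] consists of the pairs
    [(x, x')] with [w x = w x'].  Relate [(x, x')] to [(y, y')] when [x R y] and
    [x' R y']; this is an equivalence relation [S] on [K], and [pi0] and [pi1]
    both underlie maps of equivalence relations [S -> R].  Let
    [u' = <u, u> : U -> K].

    The point is that [u'] is normal to [S].  If [(u p, u p)] is related to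
    [(y, y')], then, [u] being normal to [R], [y = u q] and [y' = u q'] for some
    [q] and [q'].  Since [(y, y')] lies in [K], [v q = w y = w y' = v q'], so that
    [q = q'] because [v] is monic: the class of [(u p, u p)] stays inside the
    image of [u'] ([discrete_fibration_leg]).

    Now [pi0] and [pi1] are two maps [K -> X] that have the same composite with
    [w], send [u'] to [u] and respect the relations.  The uniqueness clause of
    the universal property gives [pi0 = pi1], and a map whose kernel pair has
    equal legs is monic.

    In the language of the category, [S] is itself a kernel pair, that of
    [<w d0, w d1> : R -> T x T].  So the whole construction only asks for
    pullbacks and binary products, and the latter are pullbacks over the terminal
    object that pointedness provides. *)

Set Implicit Arguments.
Unset Strict Implicit.
Unset Printing Implicit Defensive.

(** * Pullbacks and products from finite limits *)

Inductive cospan_obj : Set := Left | Right | Apex.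

Definition cospan_hom (i j : cospan_obj) : Set :=
  match i, j with
  | Left, Left | Right, Right | _, Apex => unit
  | _, _ => Empty_set
  end.

Definition cospan_id (i : cospan_obj) : cospan_hom i i :=
  match i with Left => tt | Right => tt | Apex => tt end.

Definition cospan_comp (i j k : cospan_obj) :
  cospan_hom j k -> cospan_hom i j -> cospan_hom i k.
Proof. by case: i; case: j; case: k => //= -[] []; exact tt. Defined.

Definition cospan : category.
Proof.
refine (@Category cospan_obj cospan_hom cospan_id cospan_comp _ _ _).
- by case; case; case.
- by case; case; case.
- by case; case; case; case; case; case; case.
Defined.

Lemma cospan_finite : finite_category cospan.
Proof.
split; first by exists (Left :: Right :: Apex :: nil); case=> /=; tauto.
by case; case; (exists nil; case; fail) || (exists (tt :: nil); case; left).
Qed.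

Section Limits.

Variable E : category.

Section CospanFunctor.

Variables (A B C : E) (f : hom A C) (g : hom B C).

Definition cospan_fobj (i : cospan_obj) : E :=
  match i with Left => A | Right => B | Apex => C end.

Definition cospan_fmap (i j : cospan_obj) :
  cospan_hom i j -> hom (cospan_fobj i) (cospan_fobj j) :=
  match i, j
    return cospan_hom i j -> hom (cospan_fobj i) (cospan_fobj j) with
  | Left, Left => fun _ => idm A
  | Right, Right => fun _ => idm B
  | Apex, Apex => fun _ => idm C
  | Left, Apex => fun _ => f
  | Right, Apex => fun _ => g
  | Left, Right | Right, Left | Apex, Left | Apex, Right =>
      fun e => match e with end
  end.

Definition cospan_functor : functor cospan E.
Proof.
refine (@Functor cospan E cospan_fobj cospan_fmap _ _).
- by case.
- by case; case; case; case; case=> /=; rewrite ?comp1m ?compm1.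
Defined.

End CospanFunctor.

Lemma pullback_exists (HE : finitely_complete E) (A B C : E)
    (f : hom A C) (g : hom B C) :
  exists (P : E) (p : hom P A) (q : hom P B), is_pullback f g p q.
Proof.
have [L [p [Hcone Huniv]]] := HE _ (cospan_functor f g) cospan_finite.
exists L, (p Left), (p Right); split.
  exact: eq_trans (Hcone Left Apex tt) (eq_sym (Hcone Right Apex tt)).
move=> Z a b eq_ab.
pose q (j : cospan) : hom Z (cospan_functor f g j) :=
  match j with Left => a | Right => b | Apex => f ∘ a end.
have q_cone : is_cone q.
  by case; case; case=> /=; rewrite ?comp1m.
have [h [Hh h_uniq]] := Huniv Z q q_cone.
exists h; split; first by split; [exact: (Hh Left) | exact: (Hh Right)].
move=> k [ka kb]; apply: h_uniq; case=> //.
(* the apex component of a cone is determined by its left component *)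
by rewrite -(Hcone Left Apex tt) -compA ka.
Qed.

Lemma pullback_jointly_monic (A B C P : E) (f : hom A C) (g : hom B C)
    (p : hom P A) (q : hom P B) (Hpb : is_pullback f g p q)
    (Z : E) (a b : hom Z P) :
  p ∘ a = p ∘ b -> q ∘ a = q ∘ b -> a = b.
Proof.
move=> eqp eqq; case: Hpb => Hsq Huniv.
have Hc : f ∘ (p ∘ b) = g ∘ (q ∘ b) by rewrite !compA Hsq.
have [h [_ h_uniq]] := Huniv _ _ _ Hc.
by rewrite -(h_uniq a) // -(h_uniq b).
Qed.

Lemma product_jointly_monic (A B P : E) (p : hom P A) (q : hom P B)
    (Hp : is_product p q) (Z : E) (a b : hom Z P) :
  p ∘ a = p ∘ b -> q ∘ a = q ∘ b -> a = b.
Proof.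
move=> eqp eqq; have [h [_ h_uniq]] := Hp _ (p ∘ b) (q ∘ b).
by rewrite -(h_uniq a) // -(h_uniq b).
Qed.

Lemma product_exists (HE : finitely_complete E) (HP : pointed E) (A B : E) :
  exists (P : E) (p : hom P A) (q : hom P B), is_product p q.
Proof.
have [O [_ O_term]] := HP.
have [a0 _] := O_term A; have [b0 _] := O_term B.
have [P [p [q [_ Huniv]]]] := pullback_exists HE a0 b0.
exists P, p, q => Z a b; apply: Huniv.
have [z [_ z_uniq]] := O_term Z.
by rewrite -(z_uniq (a0 ∘ a)) // -(z_uniq (b0 ∘ b)).
Qed.

Lemma kernel_pair_monic (A B K : E) (f : hom A B) (p q : hom K A) :
  is_pullback f f p q -> p = q -> monic f.
Proof.
move=> [_ Huniv] eq_pq Z a b eq_ab.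
by have [h [[<- <-] _]] := Huniv Z a b eq_ab; rewrite eq_pq.
Qed.

(** * Relations on generalized elements *)

(** Transitivity is only given on the object of composable pairs; every two
    composable generalized elements factor through it. *)
Lemma transitive_elements (HE : finitely_complete E) (X : E) (R : graph X)
    (HR : transitive_graph R) (Z : E) (a b : hom Z (carrier R)) :
  d1 R ∘ a = d0 R ∘ b ->
  exists c : hom Z (carrier R), d0 R ∘ c = d0 R ∘ a /\ d1 R ∘ c = d1 R ∘ b.
Proof.
move=> eq_ab; have [P [p [q Hpb]]] := pullback_exists HE (d1 R) (d0 R).
have [m [m0 m1]] := HR _ _ _ Hpb.
have [h [[<- <-] _]] := (proj2 Hpb) _ _ _ eq_ab.
by exists (m ∘ h); rewrite !compA m0 m1.
Qed.

(** The inverse image condition comes for free from a graph map out of the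
    indiscrete relation: it says that all pairs of elements of [U] become
    related under [u], and an element of a relation is determined by its ends. *)
Lemma normal_to_discrete_fibration (HE : finitely_complete E) (HP : pointed E)
    (U X : E) (u : hom U X) (R : graph X) (N : graph U)
    (ut : hom (carrier N) (carrier R)) :
  jointly_monic R -> is_indiscrete N -> graph_map u ut ->
  discrete_fibration u ut -> normal_to u R.
Proof.
move=> R_jm N_ind ut_map ut_df; exists N, ut; split=> //; split=> //.
have [XX [q0 [q1 Hq]]] := product_exists HE HP X X.
have [r [[r0 r1] _]] := Hq _ (d0 R) (d1 R).
have [uu [[uu0 uu1] _]] := Hq _ (u ∘ d0 N) (u ∘ d1 N).
have [ut0 ut1] := ut_map.
(* the carrier of [N] is itself a product U x U *)
exists (carrier N), XX, (d0 N), (d1 N), q0, q1, (idm _), r, uu.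
do 2 split=> //; split; first by rewrite !compm1.
do 2 split=> //; split.
  rewrite compm1; apply: (product_jointly_monic Hq).
    by rewrite compA r0 ut0 uu0.
  by rewrite compA r1 ut1 uu1.
move=> Z s m eq_sm; exists m; split; last by move=> k [_ <-]; rewrite comp1m.
split; last by rewrite comp1m.
apply: R_jm.
- by rewrite compA ut0 -uu0 -compA -eq_sm compA r0.
- by rewrite compA ut1 -uu1 -compA -eq_sm compA r1.
Qed.

(** * The relation induced on a kernel pair *)

(** One leg of normality on the kernel pair.  The two components [rho0 s] and
    [rho1 s] of an element of [S] starting at [u' z] each lift to [N], with the
    same source [z]; their targets agree after [w ∘ u], hence agree, so that the
    two lifts coincide.  The statement is about one leg [x0] of the relation,
    with [x1] the other one, so that it applies to both. *)
Lemma discrete_fibration_leg (U T X N R K S : E)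
    (u : hom U X) (w : hom X T) (n0 n1 : hom N U) (x0 x1 : hom R X)
    (ut : hom N R) (pi0 pi1 : hom K X) (rho0 rho1 : hom S R) (k : hom S K)
    (u' : hom U K) (ut' : hom N S) :
  monic (w ∘ u) ->
  (forall Z (a b : hom Z N), n0 ∘ a = n0 ∘ b -> n1 ∘ a = n1 ∘ b -> a = b) ->
  (forall Z (a b : hom Z K), pi0 ∘ a = pi0 ∘ b -> pi1 ∘ a = pi1 ∘ b -> a = b) ->
  (forall Z (a b : hom Z S),
     rho0 ∘ a = rho0 ∘ b -> rho1 ∘ a = rho1 ∘ b -> a = b) ->
  x1 ∘ ut = u ∘ n1 -> is_pullback x0 u ut n0 ->
  w ∘ x1 ∘ rho0 = w ∘ x1 ∘ rho1 ->
  pi0 ∘ k = x0 ∘ rho0 -> pi1 ∘ k = x0 ∘ rho1 ->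
  pi0 ∘ u' = u -> pi1 ∘ u' = u ->
  rho0 ∘ ut' = ut -> rho1 ∘ ut' = ut ->
  is_pullback k u' ut' n0.
Proof.
move=> v_mon N_jm K_jm S_jm ut1 [ut0 Huniv] Srel k0 k1 u0 u1 t0 t1; split.
  apply: K_jm.
    by rewrite !compA k0 u0 -compA t0.
  by rewrite !compA k1 u1 -compA t1.
move=> Z s z eq_sz.
have e0 : x0 ∘ (rho0 ∘ s) = u ∘ z by rewrite compA -k0 -compA eq_sz compA u0.
have e1 : x0 ∘ (rho1 ∘ s) = u ∘ z by rewrite compA -k1 -compA eq_sz compA u1.
have [m [[m_ut m_n0] m_uniq]] := Huniv _ _ _ e0.
have [m' [[m'_ut m'_n0] _]] := Huniv _ _ _ e1.
have eq_m : m = m'.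
  apply: N_jm; first by rewrite m_n0.
  apply: v_mon; rewrite !compA -!(compA _ u w) -ut1 !compA -!compA m_ut m'_ut.
  by rewrite !compA Srel.
exists m; split.
  split=> //; apply: S_jm.
    by rewrite compA t0.
  by rewrite compA t1 eq_m.
by move=> l [l_s l_z]; apply: m_uniq; rewrite -l_s compA t0.
Qed.

(** The first two clauses describe [carrier S], in terms of elements, as the
    kernel pair of [<w d0, w d1>]; this spares mentioning the product [T x T].
    The two graph maps then force the legs of [S] into [K]. *)
Definition kernel_relation (X T K : E) (w : hom X T) (R : graph X)
    (pi0 pi1 : hom K X) (S : graph K) (rho0 rho1 : hom (carrier S) (carrier R))
    : Prop :=
  (forall (Z : E) (a b : hom Z (carrier R)),
     w ∘ d0 R ∘ a = w ∘ d0 R ∘ b -> w ∘ d1 R ∘ a = w ∘ d1 R ∘ b ->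
     exists s : hom Z (carrier S), rho0 ∘ s = a /\ rho1 ∘ s = b) /\
  (forall (Z : E) (a b : hom Z (carrier S)),
     rho0 ∘ a = rho0 ∘ b -> rho1 ∘ a = rho1 ∘ b -> a = b) /\
  graph_map pi0 rho0 /\ graph_map pi1 rho1.

Lemma kernel_relation_exists (HE : finitely_complete E) (HP : pointed E)
    (X T K : E) (w : hom X T) (R : graph X) (pi0 pi1 : hom K X) :
  is_pullback w w pi0 pi1 ->
  exists (S : graph K) (rho0 rho1 : hom (carrier S) (carrier R)),
    kernel_relation w pi0 pi1 rho0 rho1.
Proof.
move=> [_ Kuniv].
have [TT [t0 [t1 Ht]]] := product_exists HE HP T T.
have [f [[f0 f1] _]] := Ht _ (w ∘ d0 R) (w ∘ d1 R).
have [S [rho0 [rho1 Hpb]]] := pullback_exists HE f f.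
have [Hsq Huniv] := Hpb.
have e0 : w ∘ (d0 R ∘ rho0) = w ∘ (d0 R ∘ rho1).
  by rewrite !compA -f0 -!compA Hsq.
have e1 : w ∘ (d1 R ∘ rho0) = w ∘ (d1 R ∘ rho1).
  by rewrite !compA -f1 -!compA Hsq.
have [k0 [[k00 k01] _]] := Kuniv _ _ _ e0.
have [k1 [[k10 k11] _]] := Kuniv _ _ _ e1.
exists (Graph k0 k1), rho0, rho1; do 3 try split=> //=.
- move=> Z a b eq0 eq1.
  have eq_f : f ∘ a = f ∘ b.
    by apply: (product_jointly_monic Ht); rewrite !compA ?f0 ?f1.
  by have [s [Hs _]] := Huniv _ _ _ eq_f; exists s.
- by move=> Z a b; apply: (pullback_jointly_monic Hpb).
Qed.

Section KernelRelation.

Variables (X T K : E) (w : hom X T) (R : graph X) (pi0 pi1 : hom K X).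
Variables (S : graph K) (rho0 rho1 : hom (carrier S) (carrier R)).
Hypothesis HK : is_pullback w w pi0 pi1.
Hypothesis HS : kernel_relation w pi0 pi1 rho0 rho1.

Lemma kernel_relation_equivalence (HE : finitely_complete E) :
  equivalence_relation R -> equivalence_relation S.
Proof.
have [S_pair [S_jm [[r00 r01] [r10 r11]]]] := HS.
have K_jm := pullback_jointly_monic HK.
have eqK : w ∘ pi0 = w ∘ pi1 := proj1 HK.
move=> [R_jm [[rf [rf0 rf1]] [[sy [sy0 sy1]] R_tr]]]; split; [|split; [|split]].
- move=> Z a b eq0 eq1; apply: S_jm; apply: R_jm.
  + by rewrite !compA r00 -!compA eq0.
  + by rewrite !compA r01 -!compA eq1.
  + by rewrite !compA r10 -!compA eq0.
  + by rewrite !compA r11 -!compA eq1.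
- have [||s [s0 s1]] := S_pair _ (rf ∘ pi0) (rf ∘ pi1).
    by rewrite !compA -!(compA rf) rf0 compm1.
    by rewrite !compA -!(compA rf) rf1 compm1.
  exists s; split; apply: K_jm.
  + by rewrite compA -r00 -compA s0 compA rf0 comp1m compm1.
  + by rewrite compA -r10 -compA s1 compA rf0 comp1m compm1.
  + by rewrite compA -r01 -compA s0 compA rf1 comp1m compm1.
  + by rewrite compA -r11 -compA s1 compA rf1 comp1m compm1.
- have [||s [s0 s1]] := S_pair _ (sy ∘ rho0) (sy ∘ rho1).
    by rewrite !compA -!(compA sy) sy0 -!compA r01 r11 !compA eqK.
    by rewrite !compA -!(compA sy) sy1 -!compA r00 r10 !compA eqK.
  exists s; split; apply: K_jm.
  + by rewrite compA -r00 -compA s0 compA sy0 r01.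
  + by rewrite compA -r10 -compA s1 compA sy0 r11.
  + by rewrite compA -r01 -compA s0 compA sy1 r00.
  + by rewrite compA -r11 -compA s1 compA sy1 r10.
- move=> P p q [Hsq _].
  have e0 : d1 R ∘ (rho0 ∘ p) = d0 R ∘ (rho0 ∘ q).
    by rewrite !compA r01 r00 -!compA Hsq.
  have e1 : d1 R ∘ (rho1 ∘ p) = d0 R ∘ (rho1 ∘ q).
    by rewrite !compA r11 r10 -!compA Hsq.
  have [m0 [m00 m01]] := transitive_elements HE R_tr e0.
  have [m1 [m10 m11]] := transitive_elements HE R_tr e1.
  have [||s [s0 s1]] := S_pair _ m0 m1.
    by rewrite -!compA m00 m10 !(compA p) r00 r10 !compA eqK.
    by rewrite -!compA m01 m11 !(compA q) r01 r11 !compA eqK.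
  exists s; split; apply: K_jm.
  + by rewrite !compA -r00 -!compA s0 m00.
  + by rewrite !compA -r10 -!compA s1 m10.
  + by rewrite !compA -r01 -!compA s0 m01.
  + by rewrite !compA -r11 -!compA s1 m11.
Qed.

Lemma kernel_relation_normal (HE : finitely_complete E) (HP : pointed E)
    (U : E) (u : hom U X) (u' : hom U K) :
  monic (w ∘ u) -> jointly_monic S -> normal_to u R ->
  pi0 ∘ u' = u -> pi1 ∘ u' = u -> normal_to u' S.
Proof.
have [S_pair [S_jm [[r00 r01] [r10 r11]]]] := HS.
have K_jm := pullback_jointly_monic HK.
have eqK : w ∘ pi0 = w ∘ pi1 := proj1 HK.
move=> v_mon S_rel [N [ut [N_ind [_ [[ut0 ut1] [df0 df1]]]]]] u0 u1.
have N_jm := product_jointly_monic N_ind.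
have [ut' [t0 t1]] := S_pair _ ut ut eq_refl eq_refl.
have Srel0 : w ∘ d0 R ∘ rho0 = w ∘ d0 R ∘ rho1.
  by rewrite -!compA r00 r10 !compA eqK.
have Srel1 : w ∘ d1 R ∘ rho0 = w ∘ d1 R ∘ rho1.
  by rewrite -!compA r01 r11 !compA eqK.
have pb0 : is_pullback (d0 S) u' ut' (d0 N).
  exact: (discrete_fibration_leg v_mon N_jm K_jm S_jm ut1 df0 Srel1
            (eq_sym r00) (eq_sym r10)).
have pb1 : is_pullback (d1 S) u' ut' (d1 N).
  apply: (discrete_fibration_leg v_mon _ K_jm S_jm ut0 df1 Srel0
            (eq_sym r01) (eq_sym r11)) => //.
  by move=> Z a b eq1 eq0; apply: N_jm.
apply: (normal_to_discrete_fibration HE HP S_rel N_ind (ut := ut')) => //.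
by split; [exact: (proj1 pb0) | exact: (proj1 pb1)].
Qed.

End KernelRelation.

End Limits.

(** * Normalizers *)

Theorem proposition1p3 (E : category) (HE : finitely_complete E)
    (U T : E) (v : hom U T) (Hv : monic v)
    (HP : pointed E)
    (X : E) (u : hom U X) (R : graph X) (w : hom X T)
    (Hn : is_normalizer v u R w) :
  monic w.
Proof.
have [u_mon [R_eq [u_norm [v_def Huniv]]]] := Hn.
have [K [pi0 [pi1 HK]]] := pullback_exists HE w w.
have [S [rho0 [rho1 HS]]] := kernel_relation_exists HE HP R HK.
have [_ [_ [map0 map1]]] := HS.
have S_eq := kernel_relation_equivalence HK HS HE R_eq.
have [u' [[u0 u1] _]] := (proj2 HK) _ u u eq_refl.
have u'_mon : monic u'.
  by move=> Z a b eq_ab; apply: u_mon; rewrite -u0 -!compA eq_ab.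
rewrite v_def in Hv.
have u'_norm := kernel_relation_normal HK HS HE HP Hv (proj1 S_eq) u_norm u0 u1.
have v_fact : v = w ∘ pi0 ∘ u' by rewrite v_def -compA u0.
have [h [_ h_uniq]] := Huniv _ _ _ _ S_eq u'_mon u'_norm v_fact.
apply: (kernel_pair_monic HK); transitivity h; first symmetry; apply: h_uniq.
- by do 2 split=> //; exists rho0.
- by split; [exact: eq_sym (proj1 HK) | split=> //; exists rho1].
Qed.
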